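(* Let $\alpha\in{\mathbb R}$, let ${\mathbf A},{\mathbf B}$ be real $n\times n$ matrices, and let $$\widetilde{\mathbf A}=\begin{pmatrix}{\mathbf A}&{\mathbf B}\\ {\mathbf I}&{\mathbf O}\end{pmatrix}$$ be the corresponding $2n\times2n$ matrix. Suppose ${\mathbf A}$ and ${\mathbf B}$ can be simultaneously reduced by a (complex) similarity transformation to triangular forms ${\mathbf \Lambda}_{\mathbf A}$ and ${\mathbf \Lambda}_{\mathbf B}$. Denote by $\mu_i=a_i+ic_i$ and $\nu_i=b_i+id_i$ ($a_i,b_i,c_i,d_i\in{\mathbb R}$, $i=1,\ldots,n$) the eigenvalues of ${\mathbf A}$ and ${\mathbf B}$ respectively, where $\mu_i$ and $\nu_i$ are the $i$-th diagonal entries of ${\mathbf \Lambda}_{\mathbf A}$ and ${\mathbf \Lambda}_{\mathbf B}$. Then $\widetilde{\mathbf A}$ is ${\mathbb C}^-_\alpha$-stable if and only if ${\mathbf A}$ is ${\mathbb C}^-_{2\alpha}$-stable and for each $i=1,\ldots,n$ $$(2\alpha-a_i)^2(\alpha^2-a_i\alpha-b_i)+(2\alpha-a_i)c_i(\alpha c_i+d_i)-(\alpha c_i+d_i)^2>0.$$ In particular, $\widetilde{\mathbf A}$ is stable if and only if ${\mathbf A}$ is stable and for each $i=1,\ldots,n$ $$a_i^2b_i+a_ic_id_i+d_i^2<0.$$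
   Context: ${\mathbf I}$, ${\mathbf O}$ are the $n\times n$ identity and zero matrices. For $\gamma\in{\mathbb R}$, ${\mathbb C}^-_\gamma=\{\lambda\in{\mathbb C}:{\rm Re}(\lambda)<\gamma\}$; a matrix is ${\mathbb C}^-_\gamma$-stable if all its eigenvalues lie in ${\mathbb C}^-_\gamma$, and stable if all its eigenvalues have negative real parts. Simultaneous reduction to triangular forms means there is one invertible ${\mathbf S}$ such that ${\mathbf S}{\mathbf A}{\mathbf S}^{-1}={\mathbf \Lambda}_{\mathbf A}$ and ${\mathbf S}{\mathbf B}{\mathbf S}^{-1}={\mathbf \Lambda}_{\mathbf B}$ are both upper triangular (or both lower triangular). *)

(* Defs.v *)
From mathcomp Require Import all_boot all_order all_algebra.
From mathcomp Require Import complex.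
From mathcomp Require Import reals.

Set Implicit Arguments.
Unset Strict Implicit.
Unset Printing Implicit Defensive.

Import GRing.Theory Num.Theory.
Local Open Scope ring_scope.
Local Open Scope complex_scope.

Definition complexify (R : realType) (m n : nat) (M : 'M[R]_(m, n)) :
    'M[R[i]]_(m, n) :=
  map_mx (real_complex R) M.

Definition left_halfplane (R : realType) (gamma : R) : pred R[i] :=
  [pred l | complex.Re l < gamma].

(* The eigenvalues of a real matrix are its complex ones. *)
Definition halfplane_stable (R : realType) (gamma : R) (n : nat)
    (M : 'M[R]_n) : Prop :=
  forall l : R[i], eigenvalue (complexify M) l -> l \in left_halfplane gamma.

Definition stable (R : realType) (n : nat) (M : 'M[R]_n) : Prop :=
  forall l : R[i], eigenvalue (complexify M) l -> complex.Re l < 0.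

(* is_trig_mx means lower triangular. *)
Definition lower_triangular (F : fieldType) (n : nat) (M : 'M[F]_n) : bool :=
  is_trig_mx M.

Definition upper_triangular (F : fieldType) (n : nat) (M : 'M[F]_n) : bool :=
  is_trig_mx M^T.

Definition simultaneous_triangular_reduction (F : fieldType) (n : nat)
    (S A B LA LB : 'M[F]_n) : Prop :=
  [/\ S \in unitmx,
      S *m A *m invmx S = LA,
      S *m B *m invmx S = LB &
      (upper_triangular LA /\ upper_triangular LB) \/
      (lower_triangular LA /\ lower_triangular LB)].

Definition block_companion (R : realType) (n : nat) (A B : 'M[R]_n) :
    'M[R]_(n + n) :=
  block_mx A B 1%:M 0.

(* Main.v *)
Require Import Defs.
From mathcomp Require Import all_boot all_order all_algebra.
From mathcomp Require Import complex.
From mathcomp Require Import reals.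
From mathcomp Require Import ring lra.

(** Eliminating the second half of an eigenvector of the companion matrix shows
    that its eigenvalues are the [l] for which the quadratic pencil
    [l^2 I - l A - B] is singular ([eigenvalue_companion]). The similarity that
    triangularizes [A] and [B] triangularizes the pencil too, so the determinant
    of the pencil splits into the scalar quadratics [l^2 - l mu_i - nu_i]
    ([det_pencil_reduction]), and the companion matrix is stable exactly when
    each of these has both roots to the left of [al]. Since [A] has the
    eigenvalues [mu_i], it remains to show, one quadratic at a time, that both
    roots lie there iff [Re mu_i < 2 al] and the polynomial inequality holds
    ([quadratic_roots_left]). This is a Routh-Hurwitz criterion for complex
    quadratics; it follows from a factorization of the polynomial in terms of
    the real and imaginary parts of the two roots. The statement about plain
    stability is the case [al = 0]. *)

Import Order.TTheory GRing.Theory Num.Theory.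

Local Open Scope ring_scope.
Local Open Scope complex_scope.

(** Because the lower left block of the companion matrix is the identity,
    an eigenvector is determined by its first half [x], and the eigenvalue
    equation collapses to [x (l^2 I - l A - B) = 0]. *)
Lemma eigenvalue_companion (F : fieldType) (n : nat) (A B : 'M[F]_n) (l : F) :
  eigenvalue (block_mx A B 1%:M 0) l =
  (\det ((l ^+ 2)%:M - l *: A - B) == 0).
Proof.
have pencilE (x : 'rV_n) : x *m ((l ^+ 2)%:M - l *: A - B) =
    l *: (l *: x - x *m A) - x *m B.
  by rewrite !mulmxBr mul_mx_scalar -scalemxAr scalerBr scalerA expr2.
apply/eigenvalueP/det0P => [[v vM v_neq0]|[x x_neq0]].
- move: vM v_neq0; rewrite -[v]hsubmxK.
  move: (lsubmx v) (rsubmx v) => x y.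
  rewrite mul_row_block scale_row_mx mulmx1 mulmx0 addr0.
  case/eq_row_mx => xA xB v_neq0.
  have yE : y = l *: x - x *m A by rewrite -xA addrC addKr.
  exists x; last by rewrite pencilE -yE xB subrr.
  apply: contraNneq v_neq0 => x0.
  by rewrite yE x0 scaler0 mul0mx subrr row_mx0.
- rewrite pencilE => /subr0_eq xB.
  exists (row_mx x (l *: x - x *m A)).
    by rewrite mul_row_block scale_row_mx mulmx1 mulmx0 addr0 subrKC xB.
  by apply: contraNneq x_neq0; rewrite -row_mx0 => /eq_row_mx[-> _].
Qed.

Section SimultaneousReduction.
Context {F : fieldType} {n : nat} {S A B LA LB : 'M[F]_n}.
Hypothesis red : simultaneous_triangular_reduction S A B LA LB.

(** A pencil with three free coefficients covers both the characteristic
    polynomial of [A] ([s = 1], [t = 0]) and the quadratic pencil of the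
    companion matrix. *)
Lemma det_pencil_reduction (r s t : F) :
  \det (r%:M - s *: A - t *: B) = \prod_i (r - s * LA i i - t * LB i i).
Proof.
case: red => S_unit SA SB trigL.
have simL : S *m (r%:M - s *: A - t *: B) *m invmx S =
    r%:M - s *: LA - t *: LB.
  rewrite !mulmxBr !mulmxBl -!scalemxAr -!scalemxAl SA SB.
  by rewrite mul_mx_scalar -scalemxAl mulmxV // scalemx1.
have -> : \det (r%:M - s *: A - t *: B) = \det (r%:M - s *: LA - t *: LB).
  rewrite -simL !det_mulmx det_inv mulrAC divrr ?mul1r //.
have diagE i : (r%:M - s *: LA - t *: LB) i i = r - s * LA i i - t * LB i i.
  by rewrite !mxE eqxx.
case: trigL => -[].
- move=> /is_trig_mxP LA0 /is_trig_mxP LB0; rewrite -det_tr det_trig.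
    by apply: eq_bigr => i _; rewrite mxE diagE.
  apply/is_trig_mxP => i j ij; have := LA0 i j ij; have := LB0 i j ij.
  rewrite !mxE => -> ->.
  by rewrite eq_sym -val_eqE (ltn_eqF ij) !mulr0 !subr0.
- move=> /is_trig_mxP LA0 /is_trig_mxP LB0; rewrite det_trig.
    by apply: eq_bigr => i _; rewrite diagE.
  apply/is_trig_mxP => i j ij; rewrite !mxE LA0 // LB0 //.
  by rewrite -val_eqE (ltn_eqF ij) !mulr0 !subr0.
Qed.

Lemma eigenvalue_reduction (l : F) :
  eigenvalue A l <-> exists i, l = LA i i.
Proof.
have -> : eigenvalue A l = (\det (l%:M - 1 *: A - 0 *: B) == 0).
  rewrite scale1r scale0r subr0.
  apply/eigenvalueP/det0P => -[v].
    by move=> vA v_neq0; exists v; rewrite // mulmxBr mul_mx_scalar vA subrr.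
  by move=> v_neq0; rewrite mulmxBr mul_mx_scalar => /subr0_eq vA; exists v.
rewrite det_pencil_reduction; split.
  move/prodf_eq0 => [i _]; rewrite mul1r mul0r subr0 => /eqP/subr0_eq ->.
  by exists i.
case=> i ->; apply/prodf_eq0; exists i => //.
by rewrite mul1r mul0r subr0 subrr.
Qed.

Lemma eigenvalue_companion_reduction (l : F) :
  eigenvalue (block_mx A B 1%:M 0) l <->
  exists i, l ^+ 2 - l * LA i i - LB i i = 0.
Proof.
rewrite eigenvalue_companion -[B]scale1r det_pencil_reduction; split.
  by move=> /prodf_eq0[i _ /eqP]; rewrite mul1r; exists i.
by case=> i li; apply/prodf_eq0; exists i => //; rewrite mul1r li.
Qed.

End SimultaneousReduction.

Lemma quadratic_factor {C : numClosedFieldType} (mu nu : C) :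
  exists z w, mu = z + w /\ nu = - (z * w).
Proof.
pose r := sqrtC (mu ^+ 2 + 4 * nu).
have r2 : r ^+ 2 = mu ^+ 2 + 4 * nu by rewrite sqrtCK.
exists ((mu + r) / 2), ((mu - r) / 2); split; first by field.
have -> : nu = (r ^+ 2 - mu ^+ 2) / 4 by rewrite r2; field.
by field.
Qed.

(** In terms of the roots [z], [w] of the quadratic, the polynomial condition
    is the positivity of
    [(al - Re z) (al - Re w) ((2 al - Re z - Re w)^2 + (Im z - Im w)^2)].
    As soon as [Re z + Re w < 2 al] its last factor is positive, so it says
    that [al - Re z] and [al - Re w], whose sum is positive, have the same
    sign. *)
Lemma quadratic_roots_left {R : realType} (al a b c d : R) :
  (forall l : R[i], l ^+ 2 - l * (a +i* c) - (b +i* d) = 0 ->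
     complex.Re l < al) <->
  a < 2 * al /\
  0 < (2 * al - a) ^+ 2 * (al ^+ 2 - a * al - b)
      + (2 * al - a) * c * (al * c + d) - (al * c + d) ^+ 2.
Proof.
have [z [w [muE nuE]]] := quadratic_factor (a +i* c) (b +i* d).
have factE (l : R[i]) :
    l ^+ 2 - l * (a +i* c) - (b +i* d) = (l - z) * (l - w).
  by rewrite muE nuE; ring.
have rootsE : (forall l : R[i], l ^+ 2 - l * (a +i* c) - (b +i* d) = 0 ->
     complex.Re l < al) <-> complex.Re z < al /\ complex.Re w < al.
  split=> [lt_al|[z_lt w_lt] l].
    by split; apply: lt_al; rewrite factE subrr (mul0r, mulr0).
  rewrite factE => /eqP; rewrite mulf_eq0.
  by case/orP => /eqP/subr0_eq ->.
rewrite rootsE {rootsE factE}.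
case: z w muE nuE => [x1 y1] [x2 y2] /= [-> ->] [-> ->].
set E := (X in 0 < X).
have {E}-> : E = (al - x1) * (al - x2)
    * ((2 * al - x1 - x2) ^+ 2 + (y1 - y2) ^+ 2) by rewrite /E; ring.
split=> [[x1_lt x2_lt]|[sum_lt]].
  have sum_lt : x1 + x2 < 2 * al by lra.
  split=> //; rewrite !mulr_gt0 ?subr_gt0 //.
  by rewrite ltr_wpDr ?sqr_ge0 // exprn_gt0 //; lra.
rewrite pmulr_lgt0; last first.
  by rewrite ltr_wpDr ?sqr_ge0 // exprn_gt0 //; lra.
by move=> prod_gt0; split; nra.
Qed.

(** Both sides quantify over eigenvalues, and through the triangular forms both
    become quantifications over the diagonal index [i]; for each [i] what
    remains is the criterion for one scalar quadratic. *)
Lemma halfplane_stable_companion {R : realType} {n : nat} (alpha : R)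
    {A B : 'M[R]_n} {S LA LB : 'M[R[i]]_n} {a b c d : 'I_n -> R}
    (red : simultaneous_triangular_reduction
             S (complexify A) (complexify B) LA LB)
    (mu : forall i : 'I_n, LA i i = a i +i* c i)
    (nu : forall i : 'I_n, LB i i = b i +i* d i) :
  halfplane_stable alpha (block_companion A B) <->
     halfplane_stable (2 * alpha) A /\
     forall i : 'I_n,
       (2 * alpha - a i) ^+ 2 * (alpha ^+ 2 - a i * alpha - b i)
       + (2 * alpha - a i) * c i * (alpha * c i + d i)
       - (alpha * c i + d i) ^+ 2 > 0.
Proof.
have companionE : complexify (block_companion A B) =
    block_mx (complexify A) (complexify B) 1%:M 0.
  by rewrite /complexify map_block_mx map_mx1 map_mx0.
have stableA : halfplane_stable (2 * alpha) A <->
    forall i, a i < 2 * alpha.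
  split=> [stA i|a_lt l].
    suff : complex.Re (LA i i) < 2 * alpha by rewrite mu.
    by apply: stA; apply/(eigenvalue_reduction red); exists i.
  by case/(eigenvalue_reduction red) => i ->; rewrite inE mu; apply: a_lt.
rewrite stableA; split=> [st|[a_lt cond] l].
  have quad i := (quadratic_roots_left alpha (a i) (b i) (c i) (d i)).1.
  split=> i; case: (quad i) => // l li; apply: st;
    rewrite companionE; apply/(eigenvalue_companion_reduction red);
    by exists i; rewrite mu nu.
rewrite companionE; case/(eigenvalue_companion_reduction red) => i.
rewrite mu nu; apply: (quadratic_roots_left _ _ _ _ _).2.
by split.
Qed.

Theorem theorem9 (R : realType) (n : nat) (alpha : R) (A B : 'M[R]_n)
    (S LA LB : 'M[R[i]]_n) (a b c d : 'I_n -> R)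
    (red : simultaneous_triangular_reduction
             S (complexify A) (complexify B) LA LB)
    (mu : forall i : 'I_n, LA i i = a i +i* c i)
    (nu : forall i : 'I_n, LB i i = b i +i* d i) :
  (halfplane_stable alpha (block_companion A B) <->
     halfplane_stable (2 * alpha) A /\
     forall i : 'I_n,
       (2 * alpha - a i) ^+ 2 * (alpha ^+ 2 - a i * alpha - b i)
       + (2 * alpha - a i) * c i * (alpha * c i + d i)
       - (alpha * c i + d i) ^+ 2 > 0) /\
  (stable (block_companion A B) <->
     stable A /\
     forall i : 'I_n,
       a i ^+ 2 * b i + a i * c i * d i + d i ^+ 2 < 0).
Proof.
split; first exact: halfplane_stable_companion red mu nu.
have := halfplane_stable_companion 0 red mu nu.
rewrite mulr0 => stE; split=> [/stE|] [stA cond].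
  by split=> // i; have := cond i; lra.
by apply/stE; split=> // i; have := cond i; lra.
Qed.
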